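(* Let $r\ge 3$, let $\mathcal{F}$ be a family of $r$-partite $r$-graphs, and let $\gamma>0$ be such that for all $\tilde\Delta\ge 3$ and all $(r-1)$-graphs $G$ with maximum degree at most $\tilde\Delta$, $$\mathrm{ex}(G,\boldsymbol{\pi}(\mathcal{F}))=\Omega\left(\tilde\Delta^{-\gamma}(\log\tilde\Delta)^{3-r}\right)\cdot e(G)$$ (with implied constant independent of $G$ and $\tilde\Delta$). If $H$ is an $r$-partite $r$-graph with maximum degree at most $\Delta\ge 2$ such that at least half of the edges of $H$ contain an $(r-1)$-set with $(r-1)$-degree at least $D$, then $$\mathrm{ex}(H,\mathcal{F})=\Omega\left(\Delta^{-\gamma}D^{\gamma}(\log\Delta)^{2-r}\right)\cdot e(H).$$
   Context: A $k$-graph is a $k$-uniform hypergraph. For a family $\mathcal{F}$ of $k$-graphs and a $k$-graph $H$, $\mathrm{ex}(H,\mathcal{F})$ is the maximum number of edges in a subgraph of $H$ containing no member of $\mathcal{F}$. The $(r-1)$-degree of an $(r-1)$-set is the number of edges containing it. For an $r$-partite $r$-graph $F$ with $r$-partition $U_1\cup\cdots\cup U_r$ and $i\in[r]$, let $\partial F[\bigcup_{j\ne i}U_j]$ be the $(r-1)$-graph on $\bigcup_{j\ne i}U_j$ with edge set $\{e\cap\bigcup_{j\ne i}U_j: e\in E(F)\}$. The projection family $\boldsymbol{\pi}(F)$ is the set of all such $(r-1)$-graphs over all $i\in[r]$ and all $r$-partitions of $F$, and $\boldsymbol{\pi}(\mathcal{F})=\bigcup_{F\in\mathcal{F}}\boldsymbol{\pi}(F)$.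 *)

(* Defs.v *)
From HB Require Import structures.
From mathcomp Require Import all_boot all_order all_algebra.
From mathcomp Require Import boolp reals exp.

Set Implicit Arguments.
Unset Strict Implicit.
Unset Printing Implicit Defensive.

(** A hypergraph is a pair (vertex set, edge set) inside an ambient finite
    type [T]. The vertex set is part of the data, and may be smaller than [T],
    so that subgraphs and projections of a hypergraph on [T] are again
    hypergraphs on [T]. *)
Record hgraph (T : finType) := HGraph {
  hgraph_val : {set T} * {set {set T}};
  hgraphP : cover hgraph_val.2 \subset hgraph_val.1 }.

HB.instance Definition _ (T : finType) := [isSub for @hgraph_val T].
HB.instance Definition _ (T : finType) := [Finite of hgraph T by <:].

Definition verts (T : finType) (G : hgraph T) : {set T} := (hgraph_val G).1.
Definition edges (T : finType) (G : hgraph T) : {set {set T}} :=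
  (hgraph_val G).2.

Definition is_uniform (k : nat) (T : finType) (G : hgraph T) : Prop :=
  forall e, e \in edges G -> #|e| = k.

Definition subgraph (T : finType) (G' G : hgraph T) : bool :=
  (verts G' \subset verts G) && (edges G' \subset edges G).

(** [contains G F]: some (not necessarily induced) subgraph of [G] is
    isomorphic to [F]. *)
Definition contains (S T : finType) (G : hgraph T) (F : hgraph S) : Prop :=
  exists f : S -> T,
    [/\ {in verts F &, injective f},
        f @: verts F \subset verts G &
        forall e, e \in edges F -> f @: e \in edges G].

(** A possibly infinite family of finite hypergraphs. It need not be closed
    under isomorphism, since [contains] is isomorphism invariant. *)
Definition hfamily := forall T : finType, hgraph T -> Prop.

Definition family_free (FF : hfamily) (T : finType) (G : hgraph T) : Prop :=
  forall (S : finType) (F : hgraph S), FF S F -> ~ contains G F.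

(** The value is 0 when no subgraph of [H] is [FF]-free. *)
Definition ex_rel (T : finType) (H : hgraph T) (FF : hfamily) : nat :=
  \max_(G : hgraph T | subgraph G H && `[< family_free FF G >]) #|edges G|.

Definition set_degree (T : finType) (G : hgraph T) (A : {set T}) : nat :=
  #|[set e in edges G | A \subset e]|.

Definition max_degree (T : finType) (G : hgraph T) : nat :=
  \max_(v in verts G) set_degree G [set v].

Definition is_partition (r : nat) (T : finType) (F : hgraph T)
    (U : 'I_r -> {set T}) : Prop :=
  [/\ \bigcup_(i < r) U i = verts F,
      forall i j : 'I_r, i != j -> [disjoint U i & U j] &
      forall e, e \in edges F -> forall i : 'I_r, #|e :&: U i| = 1].

Definition is_partite (r : nat) (T : finType) (F : hgraph T) : Prop :=
  exists U : 'I_r -> {set T}, is_partition F U.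

Lemma hgraph_trace_subproof (T : finType) (F : hgraph T) (W : {set T}) :
  cover [set e :&: W | e in edges F] \subset W.
Proof. by apply/bigcupsP => _ /imsetP[e _ ->]; exact: subsetIr. Qed.

(** The hypergraph on [W] whose edges are the [e :&: W]; for
    [W = \bigcup_(j | j != i) U j] this is the projection
    $\partial F[\bigcup_{j \neq i} U_j]$. *)
Definition hgraph_trace (T : finType) (F : hgraph T) (W : {set T}) : hgraph T :=
  @HGraph T (W, [set e :&: W | e in edges F]) (hgraph_trace_subproof F W).

Definition projection_family (r : nat) (FF : hfamily) : hfamily :=
  fun T G =>
    exists (F : hgraph T) (U : 'I_r -> {set T}) (i : 'I_r),
      [/\ FF T F, is_partition F U & G = hgraph_trace F (\bigcup_(j | j != i) U j)].

Definition heavy_edges (R : realType) (T : finType) (H : hgraph T) (k : nat)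
    (D : R) : {set {set T}} :=
  [set e in edges H | [exists A : {set T},
    [&& A \subset e, #|A| == k & (D <= (set_degree H A)%:R)%R]]].

(* Main.v *)
(** Let U_1, ..., U_r be an r-partition of H. A heavy edge e has, for some i, a
    trace A = e \ U_i of degree at least D; sort these edges by i and by the j
    with 2^j <= deg A < 2^(j+1), which makes O(log Delta) classes. For one class
    put d = max(D, 2^j) and let G be the (r-1)-graph of the traces A. Every edge
    of G extends to between d and 2d edges of H, so G has maximum degree at most
    Delta / d and at least |class| / (2d) edges. If G' is a subgraph of G free
    of the projections, then the edges of H with trace in G' form an FF-free
    subgraph, with at least d e(G') edges. Applying the hypothesis to G with
    Delta' = 3 Delta / d bounds the size of each class, and summing over the
    classes costs the additional factor log Delta. *)

Require Import Defs.
From mathcomp Require Import all_boot all_order all_algebra.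
From mathcomp Require Import boolp reals exp.
From mathcomp Require Import ring lra.

Set Implicit Arguments.
Unset Strict Implicit.
Unset Printing Implicit Defensive.

Import Order.TTheory GRing.Theory Num.Theory.

(** * Traces of edges and their degrees *)

Definition coparts (r : nat) (T : finType) (U : 'I_r -> {set T}) (i : 'I_r) :
    {set T} := \bigcup_(j | j != i) U j.

Lemma edge_sub_verts (T : finType) (G : hgraph T) (e : {set T}) :
  e \in edges G -> e \subset verts G.
Proof. by move=> eG; apply: subset_trans (hgraphP G); apply: bigcup_sup eG. Qed.

Lemma edge_trace (r : nat) (T : finType) (H : hgraph T) (U : 'I_r -> {set T})
    (i : 'I_r) (e : {set T}) :
  is_partition H U -> e \in edges H -> e :&: coparts U i = e :\: U i.
Proof.
move=> [UV dis _] /edge_sub_verts/subsetP eV; apply/setP => x; rewrite !inE.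
rewrite andbC; case xe: (x \in e); last by rewrite !andbF.
rewrite !andbT; apply/bigcupP/idP => [[j jDi xUj]|xNUi].
  by rewrite (disjointFr (dis _ _ jDi) xUj).
have := eV _ xe; rewrite -UV => /bigcupP[j _ xUj]; exists j => //.
by apply: contraNneq xNUi => <-.
Qed.

Lemma card_edge_trace (r : nat) (T : finType) (H : hgraph T)
    (U : 'I_r -> {set T}) (i : 'I_r) (e : {set T}) :
  is_uniform r H -> is_partition H U -> e \in edges H ->
  #|e :&: coparts U i| = r.-1.
Proof.
move=> Hr HU eH; rewrite (edge_trace i HU eH) cardsD (Hr _ eH).
by case: HU => _ _ -> //; rewrite subn1.
Qed.

(** All traces have [r.-1] vertices, so an edge containing a trace can have no other trace. Degrees
    of traces thus become fibre sizes of the trace map, which can be summed. *)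
Lemma set_degree_trace (r : nat) (T : finType) (H : hgraph T)
    (U : 'I_r -> {set T}) (i : 'I_r) (e : {set T}) :
  is_uniform r H -> is_partition H U -> e \in edges H ->
  set_degree H (e :&: coparts U i) =
  #|[set e' in edges H | e' :&: coparts U i == e :&: coparts U i]|.
Proof.
move=> Hr HU eH; apply: eq_card => e'; rewrite !inE.
case e'H: (e' \in edges H) => //=; apply/idP/eqP => [sub|<-]; last exact: subsetIl.
apply/esym/eqP; rewrite eqEcard !(card_edge_trace _ Hr) // leqnn andbT.
by rewrite subsetI sub subsetIr.
Qed.

Lemma card_fibers (S T : finType) (f : S -> T) (E : {set S}) (B : {set T}) :
  #|[set x in E | f x \in B]| = \sum_(y in B) #|[set x in E | f x == y]|.
Proof.
rewrite -sum1_card (partition_big f [in B]) => [|x]; last first.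
  by rewrite inE => /andP[].
apply: eq_bigr => y yB; rewrite -sum1_card; apply: eq_bigl => x; rewrite !inE.
by case: eqP => [->|]; rewrite ?yB ?andbT ?andbF.
Qed.

(** Any [x] in [A] lies in every edge containing [A]; an [x] outside [verts H] forces degree 0. *)
Lemma set_degree_le_max (T : finType) (H : hgraph T) (A : {set T}) :
  (0 < #|A|)%N -> set_degree H A <= max_degree H.
Proof.
rewrite card_gt0 => /set0Pn[x xA].
have [xV|xNV] := boolP (x \in verts H).
  apply: (@leq_trans (set_degree H [set x])); last first.
    by rewrite /max_degree (bigD1 x) //= leq_maxl.
  apply: subset_leq_card; apply/subsetP => e; rewrite !inE => /andP[-> Ae] /=.
  by rewrite sub1set (subsetP Ae).
rewrite [set_degree _ _](_ : _ = 0) //; apply/eqP; rewrite cards_eq0.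
apply/set0Pn => -[e]; rewrite inE => /andP[/edge_sub_verts eV Ae].
by rewrite (subsetP eV) ?(subsetP Ae) in xNV.
Qed.

(** * Lifting subgraphs of a projection back to the hypergraph *)

Lemma edge_filter_subproof (T : finType) (G : hgraph T) (P : pred {set T}) :
  cover [set e in edges G | P e] \subset verts G.
Proof.
by apply/bigcupsP => e; rewrite inE => /andP[/edge_sub_verts].
Qed.

Definition edge_filter (T : finType) (G : hgraph T) (P : pred {set T}) :
  hgraph T := @HGraph T (verts G, [set e in edges G | P e])
    (edge_filter_subproof G P).

Lemma trace_lift_subproof (r : nat) (T : finType) (H : hgraph T)
    (U : 'I_r -> {set T}) (i : 'I_r) (G : hgraph T) :
  is_partition H U ->
  cover [set e in edges H | e :&: coparts U i \in edges G]
    \subset U i :|: verts G.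
Proof.
move=> HU; apply/bigcupsP => e; rewrite inE => /andP[eH].
rewrite (edge_trace i HU eH) => /edge_sub_verts/subsetP sub.
apply/subsetP => x xe; rewrite inE; case xU: (x \in U i) => //=.
by apply: sub; rewrite inE xU.
Qed.

(* [contains] also embeds isolated vertices: with all of [verts H] as vertex
   set, [trace_lift_free] would fail when [verts G] is smaller than
   [coparts U i]. *)
Definition trace_lift (r : nat) (T : finType) (H : hgraph T) (U : 'I_r -> {set T})
    (i : 'I_r) (G : hgraph T) (HU : is_partition H U) : hgraph T :=
  @HGraph T (U i :|: verts G, [set e in edges H | e :&: coparts U i \in edges G])
    (trace_lift_subproof i G HU).

Lemma verts_partition (r : nat) (T : finType) (H : hgraph T)
    (U : 'I_r -> {set T}) (i : 'I_r) :
  is_partition H U -> verts H = U i :|: coparts U i.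
Proof. by case=> <- _ _; rewrite (bigD1 i). Qed.

Lemma disjoint_coparts (r : nat) (T : finType) (H : hgraph T)
    (U : 'I_r -> {set T}) (i : 'I_r) :
  is_partition H U -> [disjoint U i & coparts U i].
Proof.
case=> _ dis _; apply: bigcup_disjoint => j jDi.
by rewrite dis // eq_sym.
Qed.

(* Pull the partition [U] of [H] back along an embedding of a forbidden [F]. *)
Lemma trace_lift_free (r : nat) (FF : hfamily) (T : finType) (H : hgraph T)
    (U : 'I_r -> {set T}) (i : 'I_r) (G : hgraph T) (HU : is_partition H U) :
  verts G \subset coparts U i ->
  family_free (projection_family r FF) G -> family_free FF (trace_lift i G HU).
Proof.
move=> GW Gfree S F FFF [f [f_inj fV fE]].
have lV : verts (trace_lift i G HU) \subset verts H.
  by rewrite (verts_partition i HU) setUS.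
have fW x : x \in verts F -> f x \in U i :|: verts G.
  by move=> xF; apply: (subsetP fV); apply: imset_f.
pose U' j := [set x in verts F | f x \in U j].
have FU' : is_partition F U'.
  case: (HU) => UV dis U1; split.
  - apply/setP => x; apply/bigcupP/idP => [[j _]|xF].
      by rewrite inE => /andP[].
    have: f x \in verts H by apply: (subsetP lV); exact: fW.
    rewrite -UV => /bigcupP[j _ fxj]; exists j => //.
    by rewrite inE xF.
  - move=> j k jDk; rewrite -setI_eq0; apply/eqP/setP => x; rewrite !inE.
    apply/negbTE; apply/negP => /andP[/andP[_ fj] /andP[_]].
    by rewrite (disjointFr (dis _ _ jDk) fj).
  - move=> e eF j; have := fE _ eF; rewrite inE => /andP[feH _].
    have eV := subsetP (edge_sub_verts eF).
    (* Since [f] is injective on [e], it maps [e :&: U' j] bijectively onto [f @: e :&: U j], a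
       single vertex. *)
    rewrite -(U1 _ feH j) -(card_in_imset (f := f)); last first.
      by move=> x y /setIP[/eV ? _] /setIP[/eV ? _]; exact: f_inj.
    apply: eq_card => y; apply/imsetP/setIP => [[x]|[/imsetP[x xe ->] fxj]].
      by rewrite !inE => /andP[xe /andP[_ fxj]] ->; split=> //; apply: imset_f.
    by exists x => //; rewrite !inE xe fxj eV.
have cop x : x \in verts F -> (x \in coparts U' i) = (f x \in coparts U i).
  move=> xF; apply/bigcupP/bigcupP => -[j ji]; rewrite ?inE => xj; exists j => //.
    by case/andP: xj.
  by rewrite inE xF.
(* The same [f] embeds this projection of [F] into [G], because it respects the parts. *)
apply: (Gfree S (hgraph_trace F (coparts U' i))).
  by exists F, U', i; split.
have sWF : coparts U' i \subset verts F.
  by rewrite (verts_partition i FU') subsetUr.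
exists f; split.
- by move=> x y xW yW; apply: f_inj; exact: (subsetP sWF).
- apply/subsetP => _ /imsetP[x xW ->]; have xF := subsetP sWF _ xW.
  have := fW _ xF; rewrite inE => /orP[fxi|//].
  by move: xW; rewrite (cop _ xF) (disjointFr (disjoint_coparts i HU) fxi).
- move=> _ /imsetP[e eF ->]; have := fE _ eF; rewrite inE => /andP[_].
  rewrite (_ : f @: e :&: coparts U i = f @: (e :&: coparts U' i)) //.
  have eV := subsetP (edge_sub_verts eF).
  apply/setP => y; apply/setIP/imsetP => [[/imsetP[x xe ->] fxW]|[x]].
    by exists x => //; rewrite inE xe cop ?eV.
  rewrite inE => /andP[xe xW] ->; split; first exact: imset_f.
  by rewrite -cop ?eV.
Qed.

Local Open Scope ring_scope.

(** The fibres of the trace map over distinct [A] are disjoint, and the fibre over [A] has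
    [set_degree H A] elements. *)
Lemma trace_lift_card (R : realType) (r : nat) (T : finType) (H : hgraph T)
    (U : 'I_r -> {set T}) (i : 'I_r) (B : {set {set T}}) (d : R) :
  is_uniform r H -> is_partition H U ->
  B \subset edges (hgraph_trace H (coparts U i)) ->
  (forall A, A \in B -> d <= (set_degree H A)%:R) ->
  d * #|B|%:R <= #|[set e in edges H | e :&: coparts U i \in B]|%:R.
Proof.
move=> Hr HU /subsetP BG dB.
rewrite card_fibers natr_sum mulr_natr -sumr_const; apply: ler_sum => A AB.
have /imsetP[e eH eA] := BG _ AB.
by rewrite eA -set_degree_trace // -eA dB.
Qed.

(** The edges of [G] at a vertex [v] lift to edges of [H] that still contain [v], at least [d] for
    each. *)
Lemma trace_lift_max_degree (R : realType) (r : nat) (T : finType) (H : hgraph T)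
    (U : 'I_r -> {set T}) (i : 'I_r) (G : hgraph T) (d : R) :
  is_uniform r H -> is_partition H U -> subgraph G (hgraph_trace H (coparts U i)) ->
  (forall A, A \in edges G -> d <= (set_degree H A)%:R) ->
  d * (max_degree G)%:R <= (max_degree H)%:R.
Proof.
move=> Hr HU /andP[GV GE] dG.
rewrite {1}/max_degree; elim/big_ind: _ => [|m n hm hn|v vG].
- by rewrite mulr0 ler0n.
- by case: (leqP m n) => _.
rewrite /set_degree; set B := [set e in edges G | _].
have BG : B \subset edges G by apply/subsetP => e; rewrite inE => /andP[].
apply: le_trans (trace_lift_card Hr HU (subset_trans BG GE) _) _.
  by move=> A /(subsetP BG)/dG.
rewrite ler_nat (leq_trans _ (set_degree_le_max H (_ : 0 < #|[set v]|)%N)) ?cards1 //.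
apply: subset_leq_card; apply/subsetP => e; rewrite !inE => /and3P[-> _].
by rewrite !sub1set inE => /andP[].
Qed.

(** Each free subgraph of [G] lifts to a free subgraph of [H] by [trace_lift_free], gaining a factor
    [d] in edges. *)
Lemma trace_lift_ex (R : realType) (r : nat) (FF : hfamily) (T : finType)
    (H : hgraph T) (U : 'I_r -> {set T}) (i : 'I_r) (G : hgraph T) (d : R) :
  is_uniform r H -> is_partition H U -> subgraph G (hgraph_trace H (coparts U i)) ->
  (forall A, A \in edges G -> d <= (set_degree H A)%:R) ->
  d * (ex_rel G (projection_family r FF))%:R <= (ex_rel H FF)%:R.
Proof.
move=> Hr HU /andP[GV GE] dG.
rewrite {1}/ex_rel; elim/big_ind: _ => [|m n hm hn|G' /andP[/andP[sV sE] /asboolP free]].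
- by rewrite mulr0 ler0n.
- by case: (leqP m n) => _.
apply: le_trans (trace_lift_card Hr HU (subset_trans sE GE) _) _.
  by move=> A /(subsetP sE)/dG.
rewrite ler_nat /ex_rel (bigD1 (trace_lift i G' HU)) ?leq_maxl //=.
have G'W := subset_trans sV GV.
apply/andP; split; last exact/asboolP/trace_lift_free.
rewrite /subgraph (verts_partition i HU) setUS //=.
by apply/subsetP => e; rewrite inE => /andP[].
Qed.

(** * Dyadic classes of heavy edges *)

Definition dyadic_class (R : realType) (r : nat) (T : finType) (H : hgraph T)
    (U : 'I_r -> {set T}) (D : R) (i : 'I_r) (j : nat) : {set {set T}} :=
  [set e in edges H | let n := set_degree H (e :&: coparts U i) in
    (D <= n%:R) && (trunc_log 2 n == j)].

Lemma heavy_edges_dyadic (R : realType) (r : nat) (T : finType) (H : hgraph T)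
    (U : 'I_r -> {set T}) (D : R) :
  (1 < r)%N -> is_uniform r H -> is_partition H U ->
  (#|heavy_edges H r.-1 D| <=
    \sum_(i < r) \sum_(j < (trunc_log 2 (max_degree H)).+1)
      #|dyadic_class H U D i j|)%N.
Proof.
move=> r1 Hr HU; rewrite pair_big /=.
apply: (@leq_trans #|\bigcup_p dyadic_class H U D p.1
    (p.2 : 'I_(trunc_log 2 (max_degree H)).+1)|); last first.
  elim/big_ind2: _ => [|A m B n hA hB|//]; first by rewrite cards0.
  by rewrite cardsU; apply: leq_trans (leq_subr _ _) (leq_add hA hB).
apply: subset_leq_card; apply/subsetP => e; rewrite inE => /andP[eH].
case/existsP => A /and3P[Ae /eqP Ar DA].
have /cards1P[x eDA] : #|e :\: A| == 1%N.
  by rewrite cardsD (setIidPr Ae) Ar (Hr _ eH) -{1}(ltn_predK r1) subSnn.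
(* The part containing the only vertex [x] of [e] outside [A] gives the index [i]. A vertex of [A]
   in that part would be a second vertex of [e] there, so [A] is the trace. *)
have /setDP[xe xNA] : x \in e :\: A by rewrite eDA set11.
have := subsetP (edge_sub_verts eH) _ xe.
case: (HU) => <- _ U1 /bigcupP[i _ xi].
have eA : e :&: coparts U i = A.
  apply/esym/eqP; rewrite eqEcard (card_edge_trace i Hr HU eH) Ar leqnn andbT.
  rewrite (edge_trace i HU eH); apply/subsetP => y yA.
  rewrite inE (subsetP Ae) // andbT; apply: contraNN xNA => yi.
  have /cards1P[z eUz] : #|e :&: U i| == 1%N by rewrite U1.
  have : x \in e :&: U i by rewrite inE xe xi.
  have : y \in e :&: U i by rewrite inE yi (subsetP Ae).
  by rewrite eUz !inE => /eqP yz /eqP ->; rewrite -yz.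
have jK : (trunc_log 2 (set_degree H A) < (trunc_log 2 (max_degree H)).+1)%N.
  rewrite ltnS leq_trunc_log // set_degree_le_max // Ar -ltnS.
  by rewrite (ltn_predK r1).
apply/bigcupP; exists (i, Ordinal jK) => //=.
by rewrite inE eH /= eA DA eqxx.
Qed.

Lemma dyadic_class_bound (R : realType) (r : nat) (FF : hfamily) (gamma c : R) :
  (3 <= r)%N -> 0 < gamma -> 0 < c ->
  (forall (Delta' : R) (T : finType) (G : hgraph T),
      3 <= Delta' -> is_uniform r.-1 G -> (max_degree G)%:R <= Delta' ->
      c * (Delta' `^ (- gamma) * ln Delta' ^ (3 - r%:Z)) * #|edges G|%:R
        <= (ex_rel G (projection_family r FF))%:R) ->
  forall (Delta D : R) (T : finType) (H : hgraph T) (U : 'I_r -> {set T}) i j,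
    2 <= Delta -> 0 < D -> is_uniform r H -> is_partition H U ->
    (max_degree H)%:R <= Delta ->
    c * (3 `^ (- gamma) * 3 ^ (3 - r%:Z))
      * (Delta `^ (- gamma) * D `^ gamma * ln Delta ^ (3 - r%:Z))
      * #|dyadic_class H U D i j|%:R
    <= 2 * (ex_rel H FF)%:R.
Proof.
move=> r3 gamma0 c0 hex Delta D T H U i j Delta2 D0 Hr HU HD.
set E := dyadic_class _ _ _ _ _.
(* An edge [e0] of the class is needed below to get [d <= Delta]. *)
have [E0|/set0Pn[e0 e0E]] := eqVneq E set0.
  by rewrite E0 cards0 mulr0 mulr_ge0 ?ler0n.
pose P (A : {set T}) := let n := set_degree H A in
  (D <= n%:R) && (trunc_log 2 n == j).
pose G := edge_filter (hgraph_trace H (coparts U i)) P.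
pose d : R := Num.max D (2 ^+ j).
have dpos : 0 < d by rewrite lt_max D0.
have GP A : A \in edges G -> d <= (set_degree H A)%:R.
  rewrite inE => /andP[_ /andP[DA /eqP jA]]; rewrite ge_max DA -natrX ler_nat -jA.
  (* [trunc_log 2 0 = 0], so the degree must be shown positive; this follows from [0 < D]. *)
  apply: trunc_logP => //; rewrite -(ltr_nat R); exact: lt_le_trans DA.
have sG : subgraph G (hgraph_trace H (coparts U i)).
  by rewrite /subgraph subxx; apply/subsetP => A; rewrite inE => /andP[].
have Gr : is_uniform r.-1 G.
  move=> A; rewrite inE => /andP[/imsetP[e eH ->] _].
  exact: card_edge_trace Hr HU eH.
have EG : [set e in edges H | e :&: coparts U i \in edges G] = E.
  apply/setP => e; rewrite !inE; case eH: (e \in edges H) => //=.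
  by rewrite (imset_f (fun e => e :&: _)).
have cE : #|E|%:R <= 2 * d * #|edges G|%:R :> R.
  rewrite -EG card_fibers natr_sum mulr_natr -sumr_const; apply: ler_sum => A AG.
  have := AG; rewrite inE => /andP[/imsetP[e eH eA] /andP[DA /eqP jA]].
  rewrite eA -(set_degree_trace i Hr) // -eA.
  apply: (@le_trans _ _ ((2 ^ j.+1)%:R)).
    by rewrite ler_nat -jA ltnW // trunc_log_ltn.
  by rewrite natrX exprS ler_pM2l // le_max lexx orbT.
have dDelta : d <= Delta.
  have : e0 :&: coparts U i \in edges G by move: e0E; rewrite -EG inE => /andP[].
  move=> AG; apply: le_trans (GP _ AG) _; apply: le_trans HD; rewrite ler_nat.
  by rewrite set_degree_le_max // (Gr _ AG) -ltnS (ltn_predK r3) (ltn_trans _ r3).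
have Delta0 : 0 < Delta by apply: lt_le_trans Delta2.
have d1 : 1 <= d by rewrite le_max -natrX ler1n expn_gt0 orbT.
have q3 : 3 <= 3 * Delta / d by rewrite ler_pdivlMr // ler_pM2l.
(* The factor 3 ensures Delta' >= 3 and costs only a constant, since
   ln (3 Delta / d) <= ln (Delta ^ 3). *)
have mG : (max_degree G)%:R <= 3 * Delta / d.
  rewrite ler_pdivlMr // mulrC; apply: le_trans (trace_lift_max_degree Hr HU sG GP) _.
  by apply: le_trans HD _; rewrite ler_peMl ?ltW //; lra.
have h1 := hex _ _ _ q3 Gr mG.
have h2 := trace_lift_ex FF Hr HU sG GP.
have lnD : 0 < ln Delta by rewrite ln_gt0 // (lt_le_trans _ Delta2) // ltr1n.
have q0 : 0 < 3 * Delta / d by apply: lt_le_trans q3.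
have lnq0 : 0 < ln (3 * Delta / d) by rewrite ln_gt0 // (lt_le_trans _ q3) // ltr1n.
have lnq : ln (3 * Delta / d) <= 3 * ln Delta.
  rewrite [3 * ln _]mulr_natl -lnXn // ler_ln ?posrE ?exprn_gt0 // ler_pdivrMr //.
  (* [1 <= d] lets the denominator go, and [3 <= Delta ^+ 2] follows from [2 <= Delta]. *)
  rewrite (@le_trans _ _ (Delta ^+ 3)) //; last by rewrite ler_peMr // exprn_ge0 // ltW.
  by rewrite exprSr ler_pM2r //; nra.
have hX : 3 `^ (- gamma) * (Delta `^ (- gamma) * D `^ gamma)
    <= (3 * Delta / d) `^ (- gamma).
  have [Delta_ge0 d_ge0] := (ltW Delta0, ltW dpos).
  rewrite !powRM ?invr_ge0 ?mulr_ge0 // -mulrA ler_pM2l ?powR_gt0 //.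
  rewrite ler_pM2l ?powR_gt0 // -powR_inv1 // -powRrM mulN1r opprK.
  apply: ge0_ler_powR; rewrite ?nnegrE //; [exact: ltW|exact: ltW|].
  by rewrite le_max lexx.
(* The exponent is nonpositive, so the upper bound [lnq] on the logarithm turns into a lower
   bound. *)
have hL : 3 ^ (3 - r%:Z) * ln Delta ^ (3 - r%:Z) <= ln (3 * Delta / d) ^ (3 - r%:Z).
  have -> : 3 - r%:Z = - (r - 3)%:Z by rewrite -subzn // opprB.
  rewrite -!exprnN -invfM lef_pV2 ?posrE ?exprn_gt0 ?mulr_gt0 ?exprn_gt0 //.
  by rewrite -exprMn lerXn2r ?nnegrE ?mulr_ge0 // ltW.
set Z := c * _ in h1.
have hZ : c * (3 `^ (- gamma) * 3 ^ (3 - r%:Z))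
      * (Delta `^ (- gamma) * D `^ gamma * ln Delta ^ (3 - r%:Z)) <= Z.
  rewrite -mulrA ler_pM2l // mulrACA ler_pM //.
    by rewrite !mulr_ge0 ?powR_ge0.
  by rewrite mulr_ge0 ?exprz_ge0 // ltW.
have Z0 : 0 <= Z by rewrite !mulr_ge0 ?powR_ge0 ?exprz_ge0 // ltW.
apply: le_trans (ler_wpM2r (ler0n _ _) hZ) _.
(* The factor [d] lost in passing from [E] to [edges G] is regained by the lift in [h2]; only the 2
   remains. *)
apply: le_trans (ler_wpM2l Z0 cE) _.
rewrite -[2 * d * _]mulrA mulrCA ler_pM2l // mulrCA.
by apply: le_trans h2; rewrite ler_pM2l.
Qed.

Theorem theorem1p5 (R : realType) (r : nat) (FF : hfamily) (gamma : R) :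
  (3 <= r)%N ->
  (forall (S : finType) (F : hgraph S), FF S F -> is_uniform r F /\ is_partite r F) ->
  0 < gamma ->
  (exists c : R, 0 < c /\
    forall (Delta' : R) (T : finType) (G : hgraph T),
      3 <= Delta' ->
      is_uniform r.-1 G ->
      (max_degree G)%:R <= Delta' ->
      c * (Delta' `^ (- gamma) * ln Delta' ^ (3 - r%:Z)) * #|edges G|%:R
        <= (ex_rel G (projection_family r FF))%:R) ->
  exists c : R, 0 < c /\
    forall (Delta D : R) (T : finType) (H : hgraph T),
      2 <= Delta ->
      0 < D ->
      is_uniform r H ->
      is_partite r H ->
      (max_degree H)%:R <= Delta ->
      (#|edges H| <= 2 * #|heavy_edges H r.-1 D|)%N ->
      c * (Delta `^ (- gamma) * D `^ gamma * ln Delta ^ (2 - r%:Z))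
          * #|edges H|%:R
        <= (ex_rel H FF)%:R.
Proof.
move=> r3 _ gamma0 [c [c0 hex]].
pose c1 := c * (3 `^ (- gamma) * 3 ^ (3 - r%:Z)).
have c1_gt0 : 0 < c1 by rewrite !mulr_gt0 ?powR_gt0 ?exprz_gt0.
have ln2_gt0 : 0 < ln 2 :> R by rewrite ln_gt0 // ltr1n.
have r_gt0 : 0 < r%:R :> R by rewrite ltr0n (ltn_trans _ r3).
(* There are [r] parts and at most [2 * ln Delta / ln 2] dyadic indices. The other two factors 2
   come from [dyadic_class_bound] and from only half of the edges being heavy. *)
exists (c1 * ln 2 / (8 * r%:R)); split; first by apply: divr_gt0; exact: mulr_gt0.
move=> Delta D T H Delta2 D0 Hr [U HU] HD heavy.
set e := (ex_rel H FF)%:R.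
have Delta0 : 0 < Delta by apply: lt_le_trans Delta2.
have ln2D : ln 2 <= ln Delta by rewrite ler_ln ?posrE.
have lnD0 : 0 < ln Delta := lt_le_trans ln2_gt0 ln2D.
have [E0|E_gt0] := posnP #|edges H|; first by rewrite E0 mulr0 ler0n.
pose K := (trunc_log 2 (max_degree H)).+1.
have m_gt0 : (0 < max_degree H)%N.
  have /card_gt0P[f fH] := E_gt0.
  apply: (@leq_trans (set_degree H f)).
    by rewrite card_gt0; apply/set0Pn; exists f; rewrite inE fH subxx.
  by rewrite set_degree_le_max // (Hr _ fH) (ltn_trans _ r3).
(* The successor in [K] costs one more [ln 2], which [ln Delta] absorbs as [2 <= Delta]. *)
have KD : K%:R * ln 2 <= 2 * ln Delta.
  have : (trunc_log 2 (max_degree H))%:R * ln 2 <= ln Delta.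
    rewrite mulr_natl -lnXn // ler_ln ?posrE ?exprn_gt0 //.
    by apply: le_trans HD; rewrite -natrX ler_nat trunc_logP.
  by rewrite /K -natr1; lra.
pose X := Delta `^ (- gamma) * D `^ gamma.
have X_ge0 : 0 <= X by rewrite mulr_ge0 ?powR_ge0.
pose L := ln Delta ^ (2 - r%:Z).
have L_ge0 : 0 <= L by rewrite exprz_ge0 // ltW.
(* The factor [ln Delta] split off here pays for the number [K] of dyadic indices. *)
have LE : ln Delta ^ (3 - r%:Z) = ln Delta * L.
  have -> : 3 - r%:Z = 1 + (2 - r%:Z) by rewrite addrA.
  by rewrite expfzDr ?expr1z // gt_eqF.
have bound : c1 * (X * (ln Delta * L)) * #|heavy_edges H r.-1 D|%:R
    <= r%:R * K%:R * (2 * e).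
  rewrite -LE.
  have := heavy_edges_dyadic D (ltn_trans (isT : 1 < 2)%N r3) Hr HU.
  rewrite -(ler_nat R) => /(ler_wpM2l _) => /(_ (c1 * (X * ln Delta ^ (3 - r%:Z)))).
  move=> le_sum; apply: le_trans (le_sum _) _.
    by rewrite mulr_ge0 ?(ltW c1_gt0) // mulr_ge0 // exprz_ge0 // ltW.
  rewrite natr_sum mulr_sumr -mulrA mulr_natl -[in leRHS](card_ord r) -sumr_const.
  apply: ler_sum => i _.
  rewrite natr_sum mulr_sumr mulr_natl -[in leRHS](card_ord K) -sumr_const.
  by apply: ler_sum => j _; exact: dyadic_class_bound.
have heavyR : #|edges H|%:R <= 2 * #|heavy_edges H r.-1 D|%:R :> R.
  by rewrite -natrM ler_nat.
have e_ge0 : 0 <= e := ler0n _ _.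
have Y_ge0 : 0 <= c1 * (X * L) by rewrite mulr_ge0 ?(ltW c1_gt0) // mulr_ge0.
have h : c1 * (X * L) * #|heavy_edges H r.-1 D|%:R * ln 2 <= 4 * r%:R * e.
  rewrite -(ler_pM2r lnD0).
  have := ler_wpM2l (mulr_ge0 (ltW r_gt0) e_ge0) KD.
  have := ler_wpM2r (ltW ln2_gt0) bound.
  nra.
rewrite -/X -/L.
rewrite (_ : _ * _ * _ = c1 * (X * L) * #|edges H|%:R * ln 2 / (8 * r%:R)); last first.
  by field; rewrite gt_eqF.
rewrite ler_pdivrMr ?mulr_gt0 //.
have := ler_wpM2r (ltW ln2_gt0) (ler_wpM2l Y_ge0 heavyR).
lra.
Qed.
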